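(* Let $\mathbf{k}$ be a commutative unitary ring, $\lambda\in\mathbf{k}$, and let $I$ be a Rota-Baxter ideal of the Rota-Baxter algebra $A_\lambda=\bigoplus_{m\ge0}\mathbf{k}\,\mathfrak{a}_m$ of weight $\lambda$. Then the ascent sets of $I$ and of its initial Rota-Baxter ideal agree: $A(I)=A(\mathrm{in}(I))$. In other words, for two Rota-Baxter ideals $I,J$ of $A_\lambda$, one has $A(I)=A(J)$ if and only if $\mathrm{in}(I)=\mathrm{in}(J)$.
   Context: The algebra $A_\lambda$: as a $\mathbf{k}$-module it is free on the basis $\{\mathfrak{a}_m\mid m\ge 0\}$; the product is the $\mathbf{k}$-bilinear product determined by $$\mathfrak{a}_m\mathfrak{a}_n=\sum_{i=0}^{\min(m,n)}\binom{m+n-i}{m}\binom{m}{i}\lambda^i\,\mathfrak{a}_{m+n-i},\qquad m,n\ge 0,$$ with identity $\mathfrak{a}_0$; it carries the $\mathbf{k}$-linear operator $P$ with $P(\mathfrak{a}_m)=\mathfrak{a}_{m+1}$ for $m\ge 0$, and $(A_\lambda,P)$ is a (commutative) Rota-Baxter algebra of weight $\lambda$. A Rota-Baxter ideal of $A_\lambda$ is an ideal $I$ of the algebra $A_\lambda$ with $P(I)\subseteq I$; the Rota-Baxter ideal generated by a subset is the smallest Rota-Baxter ideal containing it. For nonzero $f=\sum_{i=0}^n c_i\mathfrak{a}_i$ with $c_n\ne 0$, the initial term of $f$ is $\mathrm{in}(f)=c_n\mathfrak{a}_n$. The initial Rota-Baxter ideal $\mathrm{in}(I)$ of a Rota-Baxter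 ideal $I$ is the Rota-Baxter ideal of $A_\lambda$ generated by $\{\mathrm{in}(f)\mid f\in I,\ f\neq 0\}$. Ascent set: for a Rota-Baxter ideal $I$ and $j\ge 0$, let $\Omega_j=\Omega_j(I)=\{0\}\cup\{b\in\mathbf{k}\mid \exists f\in I,\ \mathrm{in}(f)=b\,\mathfrak{a}_j\}$; these are ideals of $\mathbf{k}$ with $\Omega_j\subseteq\Omega_{j+1}$. Put $\Omega_{-1}=\{0\}$ and let $s_1<s_2<\cdots$ be the integers $t\ge 0$ with $\Omega_{t-1}\subsetneq\Omega_t$, indexed by $[N_I]$ where $N_I\in\{0,1,2,\dots\}\cup\{\infty\}$ is their number. Here $[n]=\{1,\dots,n\}$ and $[\infty]$ is the set of positive integers. The ascent set is $A(I)=\{(s_j,\Omega_{s_j})\mid j\in[N_I]\}$. *)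

(* Defs.v *)
From HB Require Import structures.
From mathcomp Require Import all_boot all_order ssrAC all_algebra.
From mathcomp Require Import finmap.
From mathcomp Require Import zify.
From mathcomp Require Import monalg.
From mathcomp Require Import boolp classical_sets.

Set Implicit Arguments.
Unset Strict Implicit.
Unset Printing Implicit Defensive.

Import GRing.Theory.
Local Open Scope classical_set_scope.
Local Open Scope ring_scope.

(* The free module on the [a_m]. The library structures on [{malg k[nat]}] need
   a nontrivial [k] and the monoid product, hence the alias: here [k] may be the
   zero ring, and [lam] parametrizes the product. *)
Definition rbalg (k : comPzRingType) (lam : k) : Type := {malg k[nat]}.

Section FreeModule.
Variables (k : comPzRingType) (lam : k).
Local Notation A := (rbalg lam).

HB.instance Definition _ := GRing.Zmodule.on A.

Definition rb_coeff (f : A) (m : nat) : k := mcoeff m f.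

Definition rb_scale (c : k) (f : A) : A := [malg i in msupp f => c * f@_i].

Lemma rb_scaleE c f m : rb_coeff (rb_scale c f) m = c * rb_coeff f m.
Proof.
by rewrite /rb_coeff /rb_scale mcoeffE; case: msuppP => //; rewrite mulr0.
Qed.

Lemma rb_coeffP (f g : A) : rb_coeff f =1 rb_coeff g -> f = g.
Proof. by move=> fg; apply/malgP. Qed.

Lemma rb_coeffD (f g : A) m : rb_coeff (f + g) m = rb_coeff f m + rb_coeff g m.
Proof. exact: mcoeffD. Qed.

Fact rb_scaleA c d f : rb_scale c (rb_scale d f) = rb_scale (c * d) f.
Proof. by apply: rb_coeffP => m; rewrite !rb_scaleE mulrA. Qed.

Fact rb_scale1 : left_id 1 rb_scale.
Proof. by move=> f; apply: rb_coeffP => m; rewrite rb_scaleE mul1r. Qed.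

Fact rb_scaleDr : right_distributive rb_scale +%R.
Proof.
move=> c f g; apply: rb_coeffP => m.
by rewrite !(rb_coeffD, rb_scaleE) mulrDr.
Qed.

Fact rb_scaleDl f : {morph rb_scale^~ f : c d / c + d}.
Proof.
move=> c d; apply: rb_coeffP => m.
by rewrite !(rb_coeffD, rb_scaleE) mulrDl.
Qed.

HB.instance Definition _ := GRing.Zmodule_isLmodule.Build k A
  rb_scaleA rb_scale1 rb_scaleDr rb_scaleDl.

Definition rb_basis (m : nat) : A := << 1 *g m >>.

(* The linear map sending the basis element of index m to [h m]. *)
Definition rb_ext (V : lmodType k) (h : nat -> V) (f : A) : V :=
  \sum_(m <- msupp f) rb_coeff f m *: h m.

Lemma rb_extEw (V : lmodType k) (h : nat -> V) (f : A) (D : {fset nat}) :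
  (msupp f `<=` D)%fset -> rb_ext h f = \sum_(m <- D) rb_coeff f m *: h m.
Proof.
move=> le; rewrite /rb_ext (big_fset_incl _ le) //= => x _ /mcoeff_outdom fx0.
by rewrite /rb_coeff fx0 scale0r.
Qed.

Fact rb_ext_is_linear (V : lmodType k) (h : nat -> V) : linear (rb_ext h).
Proof.
move=> c f g; pose D := (msupp f `|` msupp g `|` msupp (c *: f + g))%fset.
rewrite (@rb_extEw _ _ (_ + _) D) ?fsubsetUr //.
rewrite (@rb_extEw _ _ f D); last by rewrite /D -fsetUA fsubsetUl.
rewrite (@rb_extEw _ _ g D); last by rewrite /D fsetUAC fsubsetUr.
rewrite scaler_sumr -big_split /=; apply: eq_bigr => m _.
by rewrite rb_coeffD rb_scaleE scalerDl scalerA.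
Qed.

HB.instance Definition _ (V : lmodType k) (h : nat -> V) :=
  GRing.isLinear.Build k A V _ (rb_ext h) (rb_ext_is_linear h).

Lemma rb_ext_basis (V : lmodType k) (h : nat -> V) m :
  rb_ext h (rb_basis m) = h m.
Proof.
rewrite (@rb_extEw _ _ _ [fset m]%fset) ?msuppU_le //.
by rewrite big_seq_fset1 /rb_coeff mcoeffUU scale1r.
Qed.

Lemma rb_basisE (f : A) : f = \sum_(m <- msupp f) rb_coeff f m *: rb_basis m.
Proof.
rewrite {1}[f]monalgE; apply: eq_bigr => m _; apply: rb_coeffP => j.
by rewrite rb_scaleE /rb_coeff !mcoeffU mulrnAr mulr1.
Qed.

Lemma rb_ind (Q : A -> Prop) : Q 0 ->
  (forall c m f, Q f -> Q (c *: rb_basis m + f)) -> forall f, Q f.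
Proof.
move=> Q0 QS f; rewrite [f]rb_basisE.
by elim/big_rec: _ => // m g _; exact: QS.
Qed.

End FreeModule.

Section Algebra.
Variables (k : comPzRingType) (lam : k).
Local Notation A := (rbalg lam).
Local Notation a := (rb_basis lam).

Definition rb_basis_mul (m n : nat) : A :=
  \sum_(i < (minn m n).+1)
    ('C(m + n - i, m)%:R * 'C(m, i)%:R * lam ^+ i) *: a (m + n - i).

Definition rb_mul (f g : A) : A :=
  rb_ext (fun m => rb_ext (rb_basis_mul m) g) f.

Definition rb_P (f : A) : A := rb_ext (fun m => a m.+1) f.

HB.instance Definition _ := GRing.Linear.copy rb_P (rb_ext (fun m => a m.+1)).

Lemma rb_PD : {morph rb_P : f g / f + g}.
Proof. exact: linearD. Qed.

Lemma rb_PZ c : {morph rb_P : f / c *: f}.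
Proof. by move=> f; rewrite /rb_P linearZ. Qed.

Lemma rb_P0 : rb_P 0 = 0.
Proof. by rewrite /rb_P linear0. Qed.

Lemma rb_P_basis m : rb_P (a m) = a m.+1.
Proof. exact: rb_ext_basis. Qed.

Lemma rb_mul_basis m n : rb_mul (a m) (a n) = rb_basis_mul m n.
Proof. by rewrite /rb_mul !rb_ext_basis. Qed.

Fact rb_mul_linl g : linear (rb_mul^~ g).
Proof. by move=> c f1 f2; rewrite /rb_mul linearP. Qed.

Fact rb_mul_linr f : linear (rb_mul f).
Proof.
move=> c g1 g2; rewrite /rb_mul scaler_sumr -big_split /=.
by apply: eq_bigr => m _; rewrite linearP /= scalerDr !scalerA mulrC.
Qed.

Fact rb_mul0l g : rb_mul 0 g = 0.
Proof. by rewrite /rb_mul linear0. Qed.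

Fact rb_mul0r f : rb_mul f 0 = 0.
Proof.
by have := rb_mul_linr f (- 1) 0 0; rewrite scaler0 addr0 scaleN1r addNr.
Qed.

Fact rb_mulDl : left_distributive rb_mul +%R.
Proof. by move=> f g h; have := rb_mul_linl h 1 f g; rewrite !scale1r. Qed.

Fact rb_mulDr : right_distributive rb_mul +%R.
Proof. by move=> h f g; have := rb_mul_linr h 1 f g; rewrite !scale1r. Qed.

Fact rb_mulZl c f g : rb_mul (c *: f) g = c *: rb_mul f g.
Proof. by have := rb_mul_linl g c f 0; rewrite rb_mul0l !addr0. Qed.

Fact rb_mulZr c f g : rb_mul f (c *: g) = c *: rb_mul f g.
Proof. by have := rb_mul_linr f c g 0; rewrite rb_mul0r !addr0. Qed.

Let M m n i : nat := 'C(m + n - i, m) * 'C(m, i).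

Let M_small m n i : (minn m n < i)%N -> M m n i = 0%N.
Proof.
rewrite /M gtn_min => /orP[im|in_]; first by rewrite (bin_small im) muln0.
have [im|im] := leqP i m; last by rewrite (bin_small im) muln0.
by rewrite bin_small //; lia.
Qed.

Let M_fact m n i : (i <= minn m n)%N ->
  (M m n i * (i`! * (m - i)`! * (n - i)`!) = (m + n - i)`!)%N.
Proof.
rewrite /M leq_min => /andP[im in_].
rewrite -(@bin_fact (m + n - i) m); last by lia.
rewrite -(bin_fact im) (_ : (m + n - i - m = n - i)%N); last by lia.
by rewrite -!mulnA.
Qed.

Let M_sym m n i : M m n i = M n m i.
Proof.
have [ile|igt] := leqP i (minn m n); last by rewrite !M_small // minnC.
have := M_fact ile; have := @M_fact n m i; rewrite minnC => /(_ ile).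
rewrite [(n + m)%N]addnC => <-; rewrite [(_ * (n - i)`! * _)%N]mulnAC => /eqP.
by rewrite eqn_pmul2r ?muln_gt0 ?fact_gt0 // => /eqP.
Qed.

Let M_rec m n i :
  (M m.+1 n.+1 i =
     M m n.+1 i + M m.+1 n i + (if i is j.+1 then M m n j else 0))%N.
Proof.
rewrite /M; case: i => [|j].
  by rewrite !subn0 !bin0 !muln1 addn0 addSn binS addnS addSn addnC.
have [jle|jgt] := leqP j (m + n); last first.
  by rewrite !(@bin_small _ j) ?(@bin_small _ j.+1) ?muln0 //; lia.
rewrite (_ : (m.+1 + n.+1 - j.+1 = (m + n - j).+1)%N); last by lia.
rewrite (_ : (m + n.+1 - j.+1 = m + n - j)%N); last by lia.
rewrite (_ : (m.+1 + n - j.+1 = m + n - j)%N); last by lia.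
by rewrite !binS; lia.
Qed.

Let basis_mulE m n N : (minn m n < N)%N ->
  rb_basis_mul m n = \sum_(i < N) ((M m n i)%:R * lam ^+ i) *: a (m + n - i).
Proof.
move=> le; rewrite /rb_basis_mul.
pose F i := ((M m n i)%:R * lam ^+ i) *: a (m + n - i).
transitivity (\sum_(i < (minn m n).+1) F i).
  by apply: eq_bigr => i _; rewrite /F /M natrM.
rewrite -!(big_mkord xpredT F) [RHS](big_cat_nat _ le) //=.
rewrite [X in _ + X]big_nat_cond [X in _ + X]big1 ?addr0 // => i.
rewrite andbT => /andP[ile _]; rewrite /F M_small //.
by rewrite mul0r scale0r.
Qed.

Let basis_mulC m n : rb_basis_mul m n = rb_basis_mul n m.
Proof.
rewrite (basis_mulE (ltnSn _)) (@basis_mulE n m (minn m n).+1) 1?minnC //.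
by apply: eq_bigr => i _; rewrite M_sym addnC.
Qed.

Let eq_scale x y (s : k) : (s != 0 -> x = y) -> s *: a x = s *: a y.
Proof. by have [->|_ ->//] := eqVneq s 0; rewrite !scale0r. Qed.

Let basis_mul_rec m n :
  rb_basis_mul m.+1 n.+1 =
    rb_P (rb_basis_mul m n.+1) + rb_P (rb_basis_mul m.+1 n)
    + lam *: rb_P (rb_basis_mul m n).
Proof.
pose N := (m + n).+2.
rewrite (@basis_mulE m.+1 n.+1 N.+1) ?(@basis_mulE m n.+1 N.+1)
  ?(@basis_mulE m.+1 n N.+1) ?(@basis_mulE m n N); try by rewrite /N; lia.
rewrite !(linear_sum rb_P) -big_split scaler_sumr /=.
rewrite [LHS]big_ord_recl [X in _ = X + _]big_ord_recl -[RHS]addrA.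
rewrite -big_split /=.
congr (_ + _).
  rewrite !rb_PZ !rb_P_basis M_rec addn0 natrD !mulrDl scalerDl !subn0.
  by rewrite !addnS addSn.
apply: eq_bigr => -[i iN] _ /=; rewrite /bump /= add1n !rb_PZ /= !rb_P_basis.
rewrite (M_rec m n i.+1) (natrD _ (_ + _)) (natrD _ (M m n.+1 i.+1)).
rewrite 2!mulrDl 2!scalerDl scalerA.
apply: (congr2 +%R); first apply: (congr2 +%R).
- apply: eq_scale => nz; suff: (i < m + n.+1)%N by lia.
  rewrite ltnNge; apply: contra_neqN nz => le.
  by rewrite M_small ?mul0r //; lia.
- apply: eq_scale => nz; suff: (i < m.+1 + n)%N by lia.
  rewrite ltnNge; apply: contra_neqN nz => le.
  by rewrite M_small ?mul0r //; lia.
- rewrite exprS mulrCA; apply: eq_scale => nz; suff: (i <= m + n)%N by lia.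
  rewrite leqNgt; apply: contra_neqN nz => le.
  by rewrite M_small ?mul0r ?mulr0 //; lia.
Qed.

Fact rb_mulC : commutative rb_mul.
Proof.
move=> f g; elim/rb_ind: f => [|c m f IH]; first by rewrite rb_mul0l rb_mul0r.
rewrite rb_mulDl rb_mulDr rb_mulZl rb_mulZr {}IH.
apply: (congr2 +%R); last by [].
apply: (congr1 (fun u => c *: u)).
elim/rb_ind: g => [|d n g IH']; first by rewrite rb_mul0l rb_mul0r.
rewrite rb_mulDl rb_mulDr rb_mulZl rb_mulZr IH' !rb_mul_basis.
by rewrite basis_mulC.
Qed.

Fact rb_mul1 : left_id (a 0) rb_mul.
Proof.
elim/rb_ind => [|c m f IH]; first by rewrite rb_mul0r.
rewrite rb_mulDr rb_mulZr IH rb_mul_basis /rb_basis_mul min0n big_ord1 /=.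
by rewrite !bin0 expr0 !mulr1 scale1r add0n subn0.
Qed.

Let lin3 (c : k) (p q r p' q' r' : A) :
  (c *: p + p') + (c *: q + q') + lam *: (c *: r + r') =
  c *: (p + q + lam *: r) + (p' + q' + lam *: r').
Proof.
rewrite !scalerDr scalerA [lam * c]mulrC -scalerA.
by rewrite [LHS](AC (2*2*2) ((1*3*5)*(2*4*6))).
Qed.

Lemma rb_mulPP f g :
  rb_mul (rb_P f) (rb_P g) =
    rb_P (rb_mul f (rb_P g)) + rb_P (rb_mul (rb_P f) g)
    + lam *: rb_P (rb_mul f g).
Proof.
elim/rb_ind: f => [|c m f IH].
  by rewrite !(rb_P0, rb_mul0l) scaler0 !addr0.
rewrite !(rb_PD, rb_PZ) /= !rb_mulDl !rb_mulZl {}IH !(rb_PD, rb_PZ) /=.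
rewrite lin3.
apply: (congr2 +%R); last by [].
apply: (congr1 (fun u => c *: u)).
elim/rb_ind: g => [|d n g IH].
  by rewrite !(rb_P0, rb_mul0r) scaler0 !addr0.
rewrite !(rb_PD, rb_PZ) /= !rb_mulDr !rb_mulZr {}IH !(rb_PD, rb_PZ) /=.
rewrite lin3.
apply: (congr2 +%R); last by [].
apply: (congr1 (fun u => d *: u)).
by rewrite !rb_P_basis !rb_mul_basis basis_mul_rec.
Qed.

Let assoc_at f g h := rb_mul f (rb_mul g h) = rb_mul (rb_mul f g) h.

Let assocPPP f g h :
  assoc_at f (rb_P g) (rb_P h) -> assoc_at (rb_P f) g (rb_P h) ->
  assoc_at (rb_P f) (rb_P g) h -> assoc_at f g (rb_P h) ->
  assoc_at f (rb_P g) h -> assoc_at (rb_P f) g h -> assoc_at f g h ->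
  assoc_at (rb_P f) (rb_P g) (rb_P h).
Proof.
rewrite /assoc_at => H1 H2 H3 H4 H5 H6 H7.
set x := rb_P f; set y := rb_P g; set z := rb_P h.
have yzE : rb_mul y z = rb_P (rb_mul g z + rb_mul y h + lam *: rb_mul g h).
  by rewrite rb_mulPP !rb_PD rb_PZ.
have xyE : rb_mul x y = rb_P (rb_mul f y + rb_mul x g + lam *: rb_mul f g).
  by rewrite rb_mulPP !rb_PD rb_PZ.
rewrite {1}yzE {1}xyE !rb_mulPP -yzE -xyE -/x -/y -/z.
rewrite -!rb_PZ -!rb_PD /=; apply: (congr1 rb_P).
rewrite !(rb_mulDl, rb_mulDr, rb_mulZl, rb_mulZr) !scalerDr !addrA.
rewrite -H1 -H2 -H3 -H4 -H5 -H6 -H7.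
by rewrite [LHS](ACl (1*2*5*3*6*4*7)).
Qed.

Let assoc_basis m n p : assoc_at (a m) (a n) (a p).
Proof.
have mul1r f : rb_mul f (a 0) = f by rewrite rb_mulC rb_mul1.
have [N] := ubnP (m + n + p); elim: N m n p => // N IH m n p lt.
rewrite /assoc_at; case: m lt => [|m]; first by rewrite !rb_mul1.
case: n => [|n]; first by rewrite rb_mul1 mul1r.
case: p => [|p] lt; first by rewrite !mul1r.
rewrite -(rb_P_basis m) -(rb_P_basis n) -(rb_P_basis p).
by apply: assocPPP; rewrite ?rb_P_basis; apply: IH; lia.
Qed.

Fact rb_mulA : associative rb_mul.
Proof.
move=> f g h; elim/rb_ind: f => [|c m f IH]; first by rewrite !rb_mul0l.
rewrite !(rb_mulDl, rb_mulZl) {}IH.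
apply: (congr2 +%R); last by [].
apply: (congr1 (fun u => c *: u)).
elim/rb_ind: g => [|d n g IH']; first by rewrite !(rb_mul0l, rb_mul0r).
rewrite !(rb_mulDl, rb_mulZl, rb_mulDr, rb_mulZr) {}IH'.
apply: (congr2 +%R); last by [].
apply: (congr1 (fun u => d *: u)).
elim/rb_ind: h => [|e p h IH'']; first by rewrite !rb_mul0r.
by rewrite !(rb_mulDr, rb_mulZr) IH'' assoc_basis.
Qed.

HB.instance Definition _ := GRing.Zmodule_isComPzRing.Build A
  rb_mulA rb_mulC rb_mul1 rb_mulDl.

Lemma rb_scalerAl (c : k) (f g : A) : c *: (f * g) = (c *: f) * g.
Proof. by rewrite /GRing.mul /= rb_mulZl. Qed.

Lemma rb_basis0 : a 0 = 1.
Proof. by []. Qed.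

Lemma rb_basisM m n :
  a m * a n = \sum_(i < (minn m n).+1)
    ('C(m + n - i, m)%:R * 'C(m, i)%:R * lam ^+ i) *: a (m + n - i).
Proof. exact: rb_mul_basis. Qed.

Lemma rota_baxter f g :
  rb_P f * rb_P g =
    rb_P (f * rb_P g) + rb_P (rb_P f * g) + lam *: rb_P (f * g).
Proof. exact: rb_mulPP. Qed.

End Algebra.

Section RotaBaxterIdeals.
Variables (k : comPzRingType) (lam : k).
Local Notation A := (rbalg lam).
Implicit Types (f g : A) (I : set A).

(* Closure under opposite and under scaling by [k] follows from [rb_idealM],
   since [c *: f = (c *: 1) * f]. *)
Record rb_ideal I : Prop := {
  rb_ideal0 : I 0;
  rb_idealD : forall f g, I f -> I g -> I (f + g);
  rb_idealM : forall g f, I f -> I (g * f);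
  rb_idealP : forall f, I f -> I (rb_P f)
}.

Definition rb_deg f : nat := \max_(m <- msupp f) m.

(* Only meaningful for [f != 0]. *)
Definition rb_init f : A := rb_coeff f (rb_deg f) *: rb_basis lam (rb_deg f).

Definition rb_initial_ideal I : set A :=
  smallest rb_ideal [set rb_init f | f in [set f | I f /\ f != 0]].

Definition rb_Omega I (j : nat) : set k :=
  [set 0] `|`
  [set b | exists f, [/\ I f, f != 0 & rb_init f = b *: rb_basis lam j]].

(* [Omega_{t - 1}], with the convention [Omega_{-1} = {0}]. *)
Definition rb_Omega_pred I (t : nat) : set k :=
  if t is t'.+1 then rb_Omega I t' else [set 0].

(* The range of the enumeration [j |-> (s_j, Omega_{s_j})], where the [s_j] are
   exactly the [t] at which [Omega] strictly increases. *)
Definition ascent_set I : set (nat * set k) :=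
  [set (t, rb_Omega I t) | t in
     [set t | rb_Omega_pred I t `<` rb_Omega I t]].

End RotaBaxterIdeals.

(* Main.v *)
(* Every [rb_Omega I j] is an ideal of [k] increasing with [j], and every
   [a_p] occurring in the product [a_m * a_n] has [p >= n]. Hence the elements
   whose [j]-th coefficient lies in [rb_Omega I j] for all [j] form a
   Rota-Baxter ideal, which is therefore exactly the initial ideal of [I]. So
   the initial ideal determines the [rb_Omega I j] and is determined by them,
   and the ascent set carries the same information by monotonicity. *)
Require Import Defs.
From mathcomp Require Import all_boot all_order all_algebra.
From mathcomp Require Import monalg.
From mathcomp Require Import boolp classical_sets.

Set Implicit Arguments.
Unset Strict Implicit.
Unset Printing Implicit Defensive.

Import GRing.Theory.
Local Open Scope classical_set_scope.
Local Open Scope ring_scope.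

(** * Coefficients and degree *)

Section Coefficients.
Variables (k : comPzRingType) (lam : k).
Local Notation A := (rbalg lam).
Local Notation a := (rb_basis lam).
Implicit Types f g : A.

Lemma rb_coeff_zero j : rb_coeff (0 : A) j = 0.
Proof. exact: mcoeff0. Qed.

Lemma rb_coeff_basis m j : rb_coeff (a m) j = (m == j)%:R.
Proof. by rewrite /rb_coeff /rb_basis mcoeffU. Qed.

Lemma rb_coeffZ c f j : rb_coeff (c *: f) j = c * rb_coeff f j.
Proof. exact: rb_scaleE. Qed.

Lemma rb_coeff_P f j :
  rb_coeff (rb_P f) j = if j is i.+1 then rb_coeff f i else 0.
Proof.
elim/rb_ind: f => [|c m f IH].
  by rewrite rb_P0; case: j => [|i]; rewrite !rb_coeff_zero.
rewrite rb_PD rb_PZ rb_P_basis rb_coeffD IH rb_coeffZ rb_coeff_basis.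
case: j {IH} => [|i]; first by rewrite mulr0 addr0.
by rewrite rb_coeffD rb_coeffZ rb_coeff_basis.
Qed.

Lemma rb_coeff_gt_deg f m : (rb_deg f < m)%N -> rb_coeff f m = 0.
Proof.
move=> lt; apply: mcoeff_outdom; apply/negP => mf.
by move: lt; rewrite ltnNge (leq_bigmax_seq (F := id)).
Qed.

Lemma rb_deg_eq f j : rb_coeff f j != 0 ->
  (forall m, (j < m)%N -> rb_coeff f m = 0) -> rb_deg f = j.
Proof.
move=> fj f0; apply/eqP; rewrite eqn_leq; apply/andP; split; last first.
  by rewrite leqNgt; apply: contra_neqN fj; exact: rb_coeff_gt_deg.
apply/bigmax_leqP_seq => m mf _; rewrite leqNgt; apply: contraL mf => /f0 fm.
by rewrite -mcoeff_neq0 negbK; apply/eqP.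
Qed.

End Coefficients.

(** * The leading-coefficient ideals [rb_Omega I j] *)

Section Omega.
Variables (k : comPzRingType) (lam : k).
Local Notation A := (rbalg lam).
Local Notation a := (rb_basis lam).
Implicit Types (f g : A) (I J : set A).

(** Trades degrees for coefficients: a witness may now be zero or have a vanishing [j]-th
    coefficient, so sums and multiples of witnesses are again witnesses without any case analysis on
    cancellation. *)
Lemma rb_OmegaP I j b : I 0 ->
  rb_Omega I j b <-> exists f, [/\ I f, rb_coeff f j = b
    & forall m, (j < m)%N -> rb_coeff f m = 0].
Proof.
move=> I0; have [->|b0] := eqVneq b 0.
  split=> _; last by left.
  by exists 0; split=> // [|m _]; exact: rb_coeff_zero.
split=> [[/eqP|[f [If _ fb]]]|[f [If fb f0]]]; first by rewrite (negbTE b0).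
  (* Comparing [j]-th coefficients forces [rb_deg f = j], since any other degree would give
     [b = 0]. *)
  have := congr1 ((@rb_coeff _ _)^~ j) fb.
  rewrite /rb_init !rb_coeffZ !rb_coeff_basis eqxx mulr1.
  have [dj|_] := eqVneq (rb_deg f) j; last first.
    by rewrite mulr0 => /esym/eqP; rewrite (negbTE b0).
  rewrite mulr1 dj => fj; exists f; split=> // m.
  by rewrite -dj; exact: rb_coeff_gt_deg.
right; exists f; split=> //.
  by apply: contra_neq b0 => ff; rewrite -fb ff rb_coeff_zero.
by rewrite /rb_init (rb_deg_eq _ f0) fb.
Qed.

Lemma rb_OmegaD I j b c : rb_ideal I ->
  rb_Omega I j b -> rb_Omega I j c -> rb_Omega I j (b + c).
Proof.
move=> idI; have I0 := rb_ideal0 idI.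
move=> /(rb_OmegaP _ _ I0) [f [If <- f0]] /(rb_OmegaP _ _ I0) [g [Ig <- g0]].
apply/(rb_OmegaP _ _ I0); exists (f + g); split=> [||m jm].
- exact: rb_idealD.
- exact: rb_coeffD.
- by rewrite rb_coeffD f0 // g0 // addr0.
Qed.

Lemma rb_OmegaM I j b c : rb_ideal I -> rb_Omega I j b -> rb_Omega I j (c * b).
Proof.
move=> idI; have I0 := rb_ideal0 idI.
move=> /(rb_OmegaP _ _ I0) [f [If <- f0]].
apply/(rb_OmegaP _ _ I0); exists (c *: f); split=> [||m jm].
- by rewrite -[f]mul1r rb_scalerAl; exact: rb_idealM.
- exact: rb_coeffZ.
- by rewrite rb_coeffZ f0 // mulr0.
Qed.

(** Applying [rb_P] to a witness raises every index by one and keeps the leading coefficient. *)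
Lemma rb_OmegaS I j : rb_ideal I -> rb_Omega I j `<=` rb_Omega I j.+1.
Proof.
move=> idI b; have I0 := rb_ideal0 idI.
move=> /(rb_OmegaP _ _ I0) [f [If <- f0]].
apply/(rb_OmegaP _ _ I0); exists (rb_P f); split=> [||[|m] // jm].
- exact: rb_idealP.
- by rewrite rb_coeff_P.
- by rewrite rb_coeff_P f0.
Qed.

Lemma rb_Omega_mono I i j : rb_ideal I -> (i <= j)%N ->
  rb_Omega I i `<=` rb_Omega I j.
Proof.
move=> idI /subnK <-; elim: (j - i)%N => // d IH.
by apply: (subset_trans IH); rewrite addSn; exact: rb_OmegaS.
Qed.

(** * Ideals cut out coefficient by coefficient, and the initial ideal *)

Definition coeffwise (W : nat -> set k) : set A :=
  [set f | forall j, W j (rb_coeff f j)].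

Lemma rb_ideal_coeffwise (W : nat -> set k) :
  (forall j, W j 0) ->
  (forall j b c, W j b -> W j c -> W j (b + c)) ->
  (forall j b c, W j b -> W j (c * b)) ->
  (forall i j, (i <= j)%N -> W i `<=` W j) ->
  rb_ideal (coeffwise W).
Proof.
move=> W0 WD WM Wmono.
have C0 : coeffwise W 0 by move=> j; rewrite rb_coeff_zero.
have CD f g : coeffwise W f -> coeffwise W g -> coeffwise W (f + g).
  by move=> Wf Wg j; rewrite rb_coeffD; exact: WD.
have CZ c f : coeffwise W f -> coeffwise W (c *: f).
  by move=> Wf j; rewrite rb_coeffZ; exact: WM.
have Cbasis b i j : (i <= j)%N -> W i b -> coeffwise W (b *: a j).
  move=> ij Wb p; rewrite rb_coeffZ rb_coeff_basis.
  by have [<-|_] := eqVneq j p; rewrite ?mulr1 ?mulr0 //; exact: Wmono Wb.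
split=> // [g f Wf|f Wf j]; last first.
  by rewrite rb_coeff_P; case: j => // j; apply: Wmono (Wf j).
elim/rb_ind: g => [|c m g IH]; first by rewrite mul0r.
rewrite mulrDl; apply: (CD) => //; rewrite -rb_scalerAl; apply: (CZ).
rewrite [f]rb_basisE mulr_sumr; apply: (big_ind _ C0 CD) => n _.
(* The product is commuted twice to pull the scalar out of its right factor. *)
rewrite mulrC -rb_scalerAl mulrC rb_basisM scaler_sumr.
apply: (big_ind _ C0 CD) => -[i /= imn] _; rewrite scalerA mulrC -scalerA; apply: (CZ).
(* The coefficient of [f] at [n] is carried to index [m + n - i], which is at least [n] because
   [i <= m]. *)
apply: Cbasis (Wf n); move: imn; rewrite ltnS leq_min => /andP[im _].
by rewrite addnC -addnBA // leq_addr.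
Qed.

Lemma rb_initial_idealE I : rb_ideal I ->
  rb_initial_ideal I = coeffwise (rb_Omega I).
Proof.
move=> idI; have O0 j : rb_Omega I j 0 by left.
apply/seteqP; split=> [f|f Of].
  (* Minimality of the initial ideal: the right-hand side is a Rota-Baxter ideal containing every
     initial term. *)
  apply; split=> [|_ [g [Ig g0] <-] j].
    apply: rb_ideal_coeffwise => // [j b c|j b c|i j].
    - exact: rb_OmegaD.
    - exact: rb_OmegaM.
    - exact: rb_Omega_mono.
  rewrite /rb_init rb_coeffZ rb_coeff_basis.
  have [<-|_] := eqVneq (rb_deg g) j; rewrite ?mulr1 ?mulr0 //.
  by right; exists g.
move=> J [idJ initJ]; rewrite [f]rb_basisE; apply: big_ind => [||m _].
- exact: rb_ideal0.
- by move=> ? ?; exact: rb_idealD.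
(* Each term of [f] is zero or is itself the initial term of some [g] in [I]. *)
case: (Of m) => [->|[g [Ig g0 <-]]]; first by rewrite scale0r; exact: rb_ideal0.
by apply: initJ; exists g.
Qed.

Lemma rb_Omega_initial I : rb_ideal I ->
  rb_Omega (rb_initial_ideal I) = rb_Omega I.
Proof.
move=> idI; rewrite rb_initial_idealE //; apply/funext => j.
have O0 i : rb_Omega I i 0 by left.
have C0 : coeffwise (rb_Omega I) 0 by move=> i; rewrite rb_coeff_zero.
apply/seteqP; split=> b; first by case/(rb_OmegaP _ _ C0) => f [Of <- _].
(* The monomial lies in the coefficientwise ideal, as its other coefficients are zero. *)
move=> Ob; apply/(rb_OmegaP _ _ C0); exists (b *: a j); split=> [i||m jm].
- rewrite rb_coeffZ rb_coeff_basis.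
  by have [<-|_] := eqVneq j i; rewrite ?mulr1 ?mulr0.
- by rewrite rb_coeffZ rb_coeff_basis eqxx mulr1.
- by rewrite rb_coeffZ rb_coeff_basis ltn_eqF // mulr0.
Qed.

(** * Passing between ascent sets and the sequence [rb_Omega] *)

Lemma eq_ascent_set I J : rb_Omega I = rb_Omega J ->
  ascent_set I = ascent_set J.
Proof. by rewrite /ascent_set /rb_Omega_pred => ->. Qed.

Lemma rb_Omega_pred_sub I t : rb_ideal I -> rb_Omega_pred I t `<=` rb_Omega I t.
Proof. by move=> idI; case: t => [b ->|t]; [left|exact: rb_OmegaS]. Qed.

Lemma ascent_set_step I t : rb_ideal I ->
  ascent_set I (t, rb_Omega I t) \/ rb_Omega I t = rb_Omega_pred I t.
Proof.
move=> idI; have sub := @rb_Omega_pred_sub I t idI.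
have [/(subset_trans _) le|nle] := pselect (rb_Omega I t `<=` rb_Omega_pred I t).
  by right; apply/seteqP; split=> //; exact: le.
by left; exists t.
Qed.

Lemma ascent_set_snd I t W : ascent_set I (t, W) -> W = rb_Omega I t.
Proof. by case=> s _ [-> ->]. Qed.

(** Strong induction on the index: if either ideal has an ascent at [t], the common ascent set
    contains the pair recording it, whose second component must be the value for both; otherwise
    both keep their previous, equal values. *)
Lemma ascent_set_inj I J : rb_ideal I -> rb_ideal J ->
  ascent_set I = ascent_set J -> rb_Omega I = rb_Omega J.
Proof.
move=> idI idJ IJ; apply/funext; elim/ltn_ind => t IH.
(* At [t = 0] both sides are the zero ideal by convention, so no separate base case arises. *)
have pred_eq : rb_Omega_pred I t = rb_Omega_pred J t.
  by case: t IH => //= t; apply.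
have [|eqI] := ascent_set_step t idI; first by rewrite IJ => /ascent_set_snd.
have [|eqJ] := ascent_set_step t idJ; first by rewrite -IJ => /ascent_set_snd.
by rewrite eqI eqJ.
Qed.

End Omega.

Theorem proposition3p8 (k : comPzRingType) (lam : k) :
  (forall I : set (rbalg lam), rb_ideal I ->
     ascent_set I = ascent_set (rb_initial_ideal I))
  /\ (forall I J : set (rbalg lam), rb_ideal I -> rb_ideal J ->
     (ascent_set I = ascent_set J <->
      rb_initial_ideal I = rb_initial_ideal J)).
Proof.
have ascent_initial (I : set (rbalg lam)) : rb_ideal I ->
    ascent_set I = ascent_set (rb_initial_ideal I).
  by move=> idI; apply: eq_ascent_set; rewrite rb_Omega_initial.
split=> // I J idI idJ; split=> [IJ|IJ].
  by rewrite !rb_initial_idealE // (ascent_set_inj idI idJ IJ).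
by rewrite ascent_initial // IJ -ascent_initial.
Qed.
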